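(* Let $f,g\in\mathbb{R}^N$ be signals on the point cloud and $\alpha\in\mathbb{R}$. The PMFHT of the $\alpha$-order manifold cross-correlation $f\star_\alpha g$ satisfies $$\widehat{(f\star_\alpha g)}^{(\alpha)}=\overline{\hat f^{(\alpha)}}\odot\hat g^{(\alpha)},$$ where $\odot$ denotes element-wise multiplication and the bar denotes entrywise complex conjugation.
   Context: Discrete Laplace–Beltrami data. Let $P=\{p_1,\dots,p_N\}\subset\mathbb{R}^3$ be a point cloud sampled from a surface and let $t>0$. For each $i$, let $\hat T_{p_i}$ be the estimated tangent plane at $p_i$ (best-fitting plane to the points of $P$ in a ball around $p_i$), and let $b_{ii}>0$ be the area of the Voronoi cell of $p_i$ in the planar Voronoi diagram, on $\hat T_{p_i}$, of the projections of the points of $P$ in a ball $B(p_i,\delta)$. Let $B=\mathrm{diag}(b_{11},\dots,b_{NN})$ (mass matrix) and let $Q$ be the real symmetric matrix with $q_{ij}=\frac{b_{ii}b_{jj}}{4\pi t^2}\exp(-\|p_i-p_j\|^2/(4t))$ for $i\ne j$ and $q_{ii}=-\sum_{j\neq i}q_{ij}$. Let $H\in\mathbb{R}^{N\times N}$ be a matrix whose columns $H_i$ are generalized eigenvectors, $QH_i=-\lambda_i BH_i$, normalized so that $H^\top BH=I$. Fractional transform. Put $F_M:=H^\top B^{1/2}$, a real orthogonal matrix. Fix a spectral decomposition $F_M=V\Omega V^*$ with $V$ unitary and $\Omega=\mathrm{diag}(\omega_1,\dots,\omega_N)$, $|\omega_i|=1$. For $\alpha\in\mathbb{R}$ put $F_M^{(\alpha)}:=V\Omega^\alpha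 V^*$ with $\Omega^\alpha=\mathrm{diag}(\omega_1^\alpha,\dots,\omega_N^\alpha)$, where $\omega_i^\alpha:=e^{\mathrm{i}\alpha\theta_i}$ for a choice of real argument $\theta_i$ of $\omega_i$ fixed once for all $\alpha$. The point cloud manifold fractional harmonic transform (PMFHT) of order $\alpha$ of a (real or complex) signal $f$ is $\hat f^{(\alpha)}:=F_M^{(\alpha)}(B^{1/2}f)\in\mathbb{C}^N$. Conjugate translation and correlation. Let $\delta_i\in\mathbb{R}^N$ be the unit impulse at point $i$ (the $i$-th standard basis vector). The conjugate translation is $T_{-i}^{(\alpha)}g:=B^{-1/2}F_M^{(-\alpha)}\bigl(\hat g^{(\alpha)}\odot\overline{\hat\delta_i^{(\alpha)}}\bigr)$. The $\alpha$-order manifold cross-correlation is $f\star_\alpha g:=\sum_{i=1}^N\overline{f(i)}\,T_{-i}^{(\alpha)}g$. *)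

(* Defs.v *)
From HB Require Import structures.
From mathcomp Require Import all_boot all_order all_algebra.
From mathcomp Require Import all_classical all_reals all_analysis.
From mathcomp Require Import complex.

Set Implicit Arguments.
Unset Strict Implicit.
Unset Printing Implicit Defensive.

Import Order.TTheory GRing.Theory Num.Theory.
Import numFieldNormedType.Exports.

Local Open Scope ring_scope.
Local Open Scope classical_set_scope.
Local Open Scope sesquilinear_scope.

Section Geometry.
Variable R : realType.

Definition dotv (u v : 'rV[R]_3) : R := (u *m v^T) 0 0.

(* The library norm `|u| on matrices is the sup norm, hence this one. *)
Definition enorm (u : 'rV[R]_3) : R := Num.sqrt (dotv u u).

(* An affine plane of R^3, given by a point and an orthonormal basis of its
   direction. *)
Record plane := Plane {
  plane_origin : 'rV[R]_3;
  plane_e1 : 'rV[R]_3;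
  plane_e2 : 'rV[R]_3;
  plane_e1_unit : dotv plane_e1 plane_e1 = 1;
  plane_e2_unit : dotv plane_e2 plane_e2 = 1;
  plane_e12_orth : dotv plane_e1 plane_e2 = 0 }.

Definition plane_point (T : plane) (z : R * R) : 'rV[R]_3 :=
  plane_origin T + z.1 *: plane_e1 T + z.2 *: plane_e2 T.

Definition plane_proj (T : plane) (x : 'rV[R]_3) : 'rV[R]_3 :=
  plane_point T (dotv (x - plane_origin T) (plane_e1 T),
                 dotv (x - plane_origin T) (plane_e2 T)).

Section PointCloud.
Variables (N : nat) (p : 'I_N -> 'rV[R]_3).

Definition fit_error (i : 'I_N) (r : R) (T : plane) : R :=
  \sum_(j < N | enorm (p j - p i) < r) enorm (p j - plane_proj T (p j)) ^+ 2.

(* Best fit in the sense of (orthogonal) least squares. *)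
Definition best_fitting_plane (i : 'I_N) (r : R) (T : plane) : Prop :=
  forall T' : plane, fit_error i r T <= fit_error i r T'.

(* The cell is described in the orthonormal coordinates of T, so that its area
   is the planar Lebesgue measure of this set. *)
Definition voronoi_cell (i : 'I_N) (delta : R) (T : plane) :
    set (measurableTypeR R * measurableTypeR R) :=
  [set z | forall j : 'I_N, enorm (p j - p i) < delta ->
     enorm (plane_point T z - plane_proj T (p i)) <=
     enorm (plane_point T z - plane_proj T (p j))].

Definition voronoi_area (i : 'I_N) (delta : R) (T : plane) : \bar R :=
  (lebesgue_measure \x lebesgue_measure)%E (voronoi_cell i delta T).

Definition lb_weight (t : R) (b : 'rV[R]_N) (i j : 'I_N) : R :=
  b 0 i * b 0 j / (4 * pi * t ^+ 2)
    * expR (- (enorm (p i - p j) ^+ 2 / (4 * t))).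

Definition lb_stiffness (t : R) (b : 'rV[R]_N) : 'M[R]_N :=
  \matrix_(i, j) if i == j then - \sum_(k < N | k != i) lb_weight t b i k
                 else lb_weight t b i j.

End PointCloud.
End Geometry.

Section Transform.
Variables (R : realType) (N : nat).
Local Notation C := R[i].

Definition toC (m n : nat) (A : 'M[R]_(m, n)) : 'M[C]_(m, n) :=
  map_mx (real_complex R) A.

Definition hadamard (u v : 'cV[C]_N) : 'cV[C]_N :=
  map2_mx (fun x y => x * y) u v.

(* exp(i x) *)
Definition cis (x : R) : C := Complex (cos x) (sin x).

Definition mass_mx (b : 'rV[R]_N) : 'M[R]_N := diag_mx b.

(* B^s; meaningful for positive b. *)
Definition mass_pow (b : 'rV[R]_N) (s : R) : 'M[R]_N :=
  diag_mx (\row_j (b 0 j `^ s)).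

Definition FM (b : 'rV[R]_N) (H : 'M[R]_N) : 'M[R]_N :=
  H^T *m mass_pow b (1 / 2).

(* V Omega^alpha V^*, where Omega = diag(exp(i theta_1), .., exp(i theta_N)). *)
Definition FMfrac (V : 'M[C]_N) (theta : 'I_N -> R) (alpha : R) : 'M[C]_N :=
  V *m diag_mx (\row_j cis (alpha * theta j)) *m V ^t*.

Definition pmfht (b : 'rV[R]_N) (V : 'M[C]_N) (theta : 'I_N -> R) (alpha : R)
    (f : 'cV[C]_N) : 'cV[C]_N :=
  FMfrac V theta alpha *m (toC (mass_pow b (1 / 2)) *m f).

Definition impulse (i : 'I_N) : 'cV[R]_N := delta_mx i 0.

Definition conj_translation (b : 'rV[R]_N) (V : 'M[C]_N) (theta : 'I_N -> R)
    (alpha : R) (i : 'I_N) (g : 'cV[C]_N) : 'cV[C]_N :=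
  toC (mass_pow b (- (1 / 2))) *m
    (FMfrac V theta (- alpha) *m
       hadamard (pmfht b V theta alpha g)
                (map_mx Num.conj (pmfht b V theta alpha (toC (impulse i))))).

Definition cross_correlation (b : 'rV[R]_N) (V : 'M[C]_N) (theta : 'I_N -> R)
    (alpha : R) (f g : 'cV[C]_N) : 'cV[C]_N :=
  \sum_(i < N) Num.conj (f i 0) *: conj_translation b V theta alpha i g.

End Transform.

(* Main.v *)
Require Import Defs.
From HB Require Import structures.
From mathcomp Require Import all_boot all_order all_algebra.
From mathcomp Require Import all_classical all_reals all_analysis.
From mathcomp Require Import complex.

(** The identity is linear algebra over the complex numbers.  The matrices
    [V Omega^alpha V^*] form a one-parameter group in [alpha]
    ([FMfracD], [FMfrac0]), because [V] is unitary and one argument of each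
    eigenvalue serves all orders.  Together with [B^(1/2) B^(-1/2) = 1] this
    makes the transform of order [alpha] undo the inverse transform inside the
    conjugate translation, so that the translate of [g] to [i] has spectrum
    [g^ (.) conj(delta_i^)] ([pmfht_conj_translation]).  The transform being
    linear, the spectrum of the correlation is
    [sum_i conj(f i) g^ (.) conj(delta_i^)], that is
    [g^ (.) conj(sum_i f i delta_i^)], and the last sum is [f^]
    because [f] is the combination of the impulses with coefficients [f i]
    ([pmfht_impulse_sum]). *)

Set Implicit Arguments.
Unset Strict Implicit.
Unset Printing Implicit Defensive.

Import Order.TTheory GRing.Theory Num.Theory.
Import numFieldNormedType.Exports.

Local Open Scope ring_scope.
Local Open Scope sesquilinear_scope.

Section FractionalTransform.
Variables (R : realType) (N : nat).
Implicit Types (b : 'rV[R]_N) (V : 'M[R[i]]_N) (theta : 'I_N -> R).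

Lemma cis0 : cis (0 : R) = 1.
Proof. by rewrite /cis cos0 sin0. Qed.

Lemma cisD (x y : R) : cis (x + y) = cis x * cis y.
Proof.
by rewrite /cis cosD sinD addrC [sin x * _ + _]addrC [- _ + _]addrC.
Qed.

(** Powers are taken entrywise on the eigenvalues, so the exponent law of
    [cis] survives conjugation by [V] once the inner [V^* V] cancels. *)
Lemma FMfracD V theta (a c : R) : V \is unitarymx ->
  FMfrac V theta a *m FMfrac V theta c = FMfrac V theta (a + c).
Proof.
move=> /unitarymxP /mulmx1C VtV.
rewrite /FMfrac !mulmxA -(mulmxA _ (V ^t*) V) VtV mulmx1.
rewrite -(mulmxA V) mulmx_diag; congr (_ *m diag_mx _ *m _).
by apply/rowP => j; rewrite !mxE mulrDl cisD.
Qed.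

Lemma FMfrac0 V theta : V \is unitarymx -> FMfrac V theta 0 = 1%:M.
Proof.
move=> /unitarymxP VVt; rewrite /FMfrac -[RHS]VVt; congr (_ *m _).
rewrite -[RHS]mulmx1 -diag_const_mx; congr (_ *m diag_mx _).
by apply/rowP => j; rewrite !mxE mul0r cis0.
Qed.

Lemma mass_powD b (s u : R) : (forall i, 0 < b 0 i) ->
  mass_pow b s *m mass_pow b u = mass_pow b (s + u).
Proof.
move=> b_gt0; rewrite /mass_pow mulmx_diag; congr diag_mx.
by apply/rowP => j; rewrite !mxE powRD // (gt_eqF (b_gt0 j)) implybT.
Qed.

Lemma mass_pow0 b : mass_pow b 0 = 1%:M.
Proof.
rewrite -diag_const_mx; congr diag_mx.
by apply/rowP => j; rewrite !mxE powRr0.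
Qed.

(** Evaluating the inverse transform recovers the prescribed spectrum; hence
    [conj_translation] is translation defined on the spectral side. *)
Lemma pmfht_conj_translation b V theta (alpha : R) (i : 'I_N) (g : 'cV_N) :
  (forall j, 0 < b 0 j) -> V \is unitarymx ->
  pmfht b V theta alpha (conj_translation b V theta alpha i g)
  = hadamard (pmfht b V theta alpha g)
      (map_mx Num.conj (pmfht b V theta alpha (toC (impulse R i)))).
Proof.
move=> b_gt0 V_unitary; rewrite {1}/pmfht /conj_translation.
set s := hadamard _ _.
rewrite (mulmxA (toC (mass_pow b (1 / 2)))) -map_mxM mass_powD // subrr.
by rewrite mass_pow0 map_mx1 mul1mx mulmxA FMfracD // subrr FMfrac0 // mul1mx.
Qed.

Lemma pmfht_sumZ b V theta (alpha : R) (a : 'I_N -> R[i])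
    (u : 'I_N -> 'cV[R[i]]_N) :
  pmfht b V theta alpha (\sum_i a i *: u i)
  = \sum_i a i *: pmfht b V theta alpha (u i).
Proof.
rewrite /pmfht mulmxA mulmx_sumr.
by apply: eq_bigr => i _; rewrite -scalemxAr mulmxA.
Qed.

Lemma pmfht_impulse_sum b V theta (alpha : R) (f : 'cV[R[i]]_N) :
  pmfht b V theta alpha f
  = \sum_i f i 0 *: pmfht b V theta alpha (toC (impulse R i)).
Proof.
rewrite -pmfht_sumZ {1}[f]matrix_sum_delta; congr pmfht.
by apply: eq_bigr => i _; rewrite big_ord1 /toC /impulse map_delta_mx.
Qed.

(** Pairing the coefficients [conj(f i)] with the spectra [conj(delta_i^)]
    conjugates the impulse expansion of [f^] as a whole, which is where the
    conjugate on [f^] comes from. *)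
Lemma pmfht_cross_correlation b V theta (alpha : R) (f g : 'cV[R[i]]_N) :
  (forall j, 0 < b 0 j) -> V \is unitarymx ->
  pmfht b V theta alpha (cross_correlation b V theta alpha f g)
  = hadamard (map_mx Num.conj (pmfht b V theta alpha f))
             (pmfht b V theta alpha g).
Proof.
move=> b_gt0 V_unitary; rewrite /cross_correlation pmfht_sumZ.
rewrite (pmfht_impulse_sum _ _ _ _ f).
under eq_bigr do rewrite pmfht_conj_translation //.
apply/colP => k; rewrite /hadamard mxE [in RHS]mxE !summxE rmorph_sum mulr_suml.
apply: eq_bigr => i _.
by rewrite !mxE rmorphM /= mulrA mulrAC.
Qed.

End FractionalTransform.

Theorem theorem5 (R : realType) (N : nat)
  (p : 'I_N -> 'rV[R]_3) (p_inj : injective p)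
  (t : R) (t_gt0 : 0 < t)
  (r : 'I_N -> R) (r_gt0 : forall i, 0 < r i)
  (T : 'I_N -> plane R) (T_fit : forall i, best_fitting_plane p i (r i) (T i))
  (delta : R) (delta_gt0 : 0 < delta)
  (b : 'rV[R]_N) (b_gt0 : forall i, 0 < b 0 i)
  (b_area : forall i, voronoi_area p i delta (T i) = (b 0 i)%:E)
  (H : 'M[R]_N) (lambda : 'I_N -> R)
  (H_eigen : forall i, lb_stiffness p t b *m col i H
                       = - lambda i *: (mass_mx b *m col i H))
  (H_orthonormal : H^T *m mass_mx b *m H = 1%:M)
  (V : 'M[R[i]]_N) (V_unitary : V \is unitarymx)
  (omega : 'rV[R[i]]_N) (omega_unit : forall i, `|omega 0 i| = 1)
  (FM_spectral : toC (FM b H) = V *m diag_mx omega *m V ^t*)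
  (theta : 'I_N -> R) (theta_arg : forall i, omega 0 i = cis (theta i))
  (f g : 'cV[R]_N) (alpha : R) :
  pmfht b V theta alpha
    (cross_correlation b V theta alpha (toC f) (toC g))
  = hadamard (map_mx Num.conj (pmfht b V theta alpha (toC f)))
             (pmfht b V theta alpha (toC g)).
Proof.
exact: pmfht_cross_correlation.
Qed.
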